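(* Let $X\subseteq\mathbb{R}^n$ be closed and convex, let $Y\subseteq\mathbb{R}^m$ be compact and convex, and let $O_X\supseteq X$ and $O_Y\supseteq Y$ be open sets. Let $g:\mathbb{R}^n\times\mathbb{R}^m\to\mathbb{R}$ be Lipschitz continuous and let $\{g_\mu:\mu>0\}$ be a family of smooth approximations of $g$ over $O_X\times O_Y$. Suppose that for any open set $\Omega$ with $\mathrm{cl}(\Omega)\subseteq O_X$, $g_\mu\to g$ uniformly on $\mathrm{cl}(\Omega)\times Y$ as $\mu\to0$. Define $v(x)=\min_{y\in Y}g(x,y)$ and, for $\mu>0$, $$v_\mu^{\rm ent}(x)=-\mu\ln\Big(\int_Y\exp\big(-\mu^{-1}g_\mu(x,y)\big)\,dy\Big).$$ Then $\{v_\mu^{\rm ent}:\mu>0\}$ is a family of smooth approximations over $O_X$ for the value function $v$.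
   Context: Smooth approximations: for an open set $O\subseteq\mathbb{R}^d$ and a continuous function $\phi:O\to\mathbb{R}$, $\{\phi_\mu:\mu>0\}$ is a family of smooth approximations for $\phi$ over $O$ if each $\phi_\mu:O\to\mathbb{R}$ is continuously differentiable and for all $\bar z\in O$, $\lim_{z\to\bar z,\ \mu\to0}\phi_\mu(z)=\phi(\bar z)$. $\mathrm{cl}$ denotes closure.
   Formalization: Y is additionally assumed to have positive Lebesgue measure (nonempty interior); otherwise, e.g. for Y a single point in R, the integral over Y is 0, so its logarithm and hence v_mu^ent are undefined. *)

(* Defs.v *)
From HB Require Import structures.
From mathcomp Require Import all_boot all_order all_algebra.
From mathcomp Require Import all_classical all_reals all_analysis.
Set Implicit Arguments.
Unset Strict Implicit.
Unset Printing Implicit Defensive.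
Import Order.TTheory GRing.Theory Num.Theory.
Import numFieldNormedType.Exports.
Local Open Scope classical_set_scope.
Local Open Scope ring_scope.

Section lebesgue_cons.
Context (R : realType) (m : nat).

Definition cons_pair (p : measurableTypeR R * m.-tuple (measurableTypeR R)) : m.+1.-tuple (measurableTypeR R) :=
  [tuple of p.1 :: p.2].

Lemma measurable_cons_pair : measurable_fun [set: measurableTypeR R * m.-tuple (measurableTypeR R)] cons_pair.
Proof. exact: measurable_cons. Qed.

Variable mu : {sigma_finite_measure set (m.-tuple (measurableTypeR R)) -> \bar R}.

Definition lebesgue_cons : set (m.+1.-tuple (measurableTypeR R)) -> \bar R :=
  pushforward (lebesgue_measure \x mu)%E cons_pair.

Let lebesgue_cons0 : lebesgue_cons set0 = 0%E.
Proof. by rewrite /lebesgue_cons /pushforward preimage_set0 measure0. Qed.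

Let lebesgue_cons_ge0 A : (0 <= lebesgue_cons A)%E.
Proof. by rewrite /lebesgue_cons /pushforward; exact: measure_ge0. Qed.

Let lebesgue_cons_sigma_additive : semi_sigma_additive lebesgue_cons.
Proof.
exact: (measure_semi_sigma_additive
  (s := measure_function_pushforward__canonical__measure_function_Measure
    (lebesgue_measure \x mu)%E measurable_cons_pair)).
Qed.

HB.instance Definition _ := isMeasure.Build _ _ _ lebesgue_cons
  lebesgue_cons0 lebesgue_cons_ge0 lebesgue_cons_sigma_additive.

Let lebesgue_cons_sigma_finite : sigma_finite setT lebesgue_cons.
Proof.
pose uncons (t : m.+1.-tuple (measurableTypeR R)) :=
  (thead t, [tuple of behead t]).
have muncons : measurable_fun setT uncons.
  apply/measurable_fun_pairP; split; first exact: measurable_tnth.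
  exact: measurable_behead.
have unconsK p : uncons (cons_pair p) = p.
  by case: p => x t; congr pair; exact/val_inj.
have /sigma_finiteP[F [TF ndF Foo]] := sigma_finiteT (@lebesgue_measure R).
have /sigma_finiteP[G [TG ndG Goo]] := sigma_finiteT mu.
exists (fun i => uncons @^-1` (F i `*` G i)).
  rewrite -preimage_bigcup (_ : \bigcup_i _ = setT) ?preimage_setT //.
  apply/seteqP; split => // -[x t] _.
  have [i _ Fix] : (\bigcup_i F i) x by rewrite -TF.
  have [j _ Gjt] : (\bigcup_i G i) t by rewrite -TG.
  exists (maxn i j) => //; split => /=.
    by move: x Fix; exact/subsetPset/ndF/leq_maxl.
  by move: t Gjt; exact/subsetPset/ndG/leq_maxr.
move=> i; have [mF Fi] := Foo i; have [mG Gi] := Goo i; split.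
  by rewrite -[X in measurable X]setTI; apply: muncons => //; exact: measurableX.
rewrite /lebesgue_cons /pushforward -comp_preimage.
rewrite (_ : uncons \o cons_pair = id); last exact/funext.
by rewrite preimage_id product_measure1E// lte_mul_pinfty// ge0_fin_numE.
Qed.

HB.instance Definition _ := Measure_isSigmaFinite.Build _ _ _ lebesgue_cons
  lebesgue_cons_sigma_finite.

End lebesgue_cons.

(* Lebesgue measure on R^m, as the m-fold product of [lebesgue_measure]; the
   sigma-algebra on [m.-tuple (measurableTypeR R)] is the product of the Borel sigma-algebras. *)
Fixpoint lebesgue_tuple (R : realType) (m : nat) :
    {sigma_finite_measure set (m.-tuple (measurableTypeR R)) -> \bar R} :=
  match m with
  | 0%N => dirac [tuple]
  | k.+1 => lebesgue_cons (lebesgue_tuple R k)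
  end.

Lemma lebesgue_tuple_box (R : realType) (m : nat) (a b : 'I_m -> R) :
  (forall i, a i <= b i) ->
  lebesgue_tuple R m
    [set t : m.-tuple (measurableTypeR R) | forall i, a i <= tnth t i <= b i] =
  (\prod_(i < m) (b i - a i))%:E.
Proof.
elim: m a b => [|m IH] a b ab.
  by rewrite big_ord0 /= diracE mem_set // => -[].
rewrite big_ord_recl EFinM /= /lebesgue_cons /pushforward.
pose B := [set t : m.-tuple (measurableTypeR R) |
  forall i, a (lift ord0 i) <= tnth t i <= b (lift ord0 i)].
have mB : measurable B.
  rewrite (_ : B = \bigcap_(i in [set: 'I_m])
      ((@tnth m R)^~ i @^-1` `[a (lift ord0 i), b (lift ord0 i)]%classic)).
    apply: fin_bigcap_measurable => // i _.
    by rewrite -[X in measurable X]setTI; exact: measurable_tnth.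
  apply/seteqP; split => [t Bt i _|t Bt i] /=; first by rewrite in_itv; exact: Bt.
  by have := Bt i I; rewrite /= in_itv.
rewrite (_ : _ @^-1` _ = `[a ord0, b ord0]%classic `*` B); last first.
  apply/seteqP; split => -[x t] /=.
    move=> h; split; first by rewrite /= in_itv; exact: (h ord0).
    by move=> i; have := h (lift ord0 i); rewrite tnthS.
  rewrite in_itv => -[/= Ax Bt] i.
  by have [j ->|->] := unliftP ord0 i; [rewrite tnthS; exact: Bt|].
rewrite product_measure1E //= IH // lebesgue_measure_itv /= lte_fin.
case: ltP => [//|ba]; rewrite mul0e.
by rewrite (_ : b ord0 - a ord0 = 0) ?mul0e //; apply/eqP; rewrite subr_eq0 eq_le ba ab.
Qed.

(* ['rV[R]_m] carries the topology and the differential structure, [m.-tuple] the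
   sigma-algebra: integrals over a subset of ['rV[R]_m] are taken over its
   preimage. *)
Definition rV_of_tuple (R : realType) (m : nat)
    (t : m.-tuple (measurableTypeR R)) : 'rV[R]_m :=
  \row_i tnth t i.

Section smooth_approximation.
Context (R : realType) (V : normedModType R).
Implicit Types (O : set V) (phi : V -> R).

(* The derivative is continuous for the operator norm. *)
Definition continuously_differentiable_on O phi :=
  (forall x, O x -> differentiable phi x) /\
  (forall x, O x -> forall e, 0 < e ->
    \forall y \near x, forall h, `|'d phi y h - 'd phi x h| <= e * `|h|).

(* Functions on [O] are represented by total functions whose values outside the
   open set [O] are irrelevant. The limit is joint in the point and in mu > 0. *)
Definition smooth_approximations O phi (phi_ : R -> V -> R) :=
  [/\ forall z, O z -> {for z, continuous phi},
      forall mu, 0 < mu -> continuously_differentiable_on O (phi_ mu) &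
      forall zbar, O zbar ->
        phi_ p.2 p.1 @[p --> (nbhs zbar, 0^'+)] --> phi zbar].

End smooth_approximation.

(* The least element of [A]; arbitrary if [A] has none. *)
Definition set_min (R : realType) (A : set R) : R := get (A `&` lbound A).

Lemma set_minE (R : realType) (A : set R) r : A r -> lbound A r -> set_min A = r.
Proof.
move=> Ar lAr; apply: get_unique => // s [As lAs].
by apply/eqP; rewrite eq_le lAs // lAr.
Qed.

Section value_function.
Context (R : realType) (n m : nat) (Y : set 'rV[R]_m).

Definition value_function (g : 'rV[R]_n * 'rV[R]_m -> R) (x : 'rV[R]_n) : R :=
  set_min [set g (x, y) | y in Y].

Definition integral_entropy (g_ : R -> 'rV[R]_n * 'rV[R]_m -> R) (mu : R)
    (x : 'rV[R]_n) : R :=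
  - mu * ln (\int[lebesgue_tuple R m]_(t in @rV_of_tuple R m @^-1` Y)
               expR (- mu^-1 * g_ mu (x, rV_of_tuple t))).

End value_function.

(* Main.v *)
From HB Require Import structures.
Require Import Defs.
From mathcomp Require Import all_boot all_order all_algebra.
From mathcomp Require Import all_classical all_reals all_analysis.
From mathcomp Require Import measurable_realfun ring lra.
Import Order.TTheory GRing.Theory Num.Theory.
Import numFieldNormedType.Exports.
Local Open Scope classical_set_scope.
Local Open Scope ring_scope.
Set Implicit Arguments.
Unset Strict Implicit.
Unset Printing Implicit Defensive.

(* Regularity: by compactness of Y, the derivative of exp(-g_mu/mu) at (x', y)
   tends to the one at (x, y) as x' tends to x, uniformly in y in Y, so one may
   differentiate under the integral sign; the integral being positive, its
   logarithm is C^1.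

   Convergence (Laplace's method): for z near x and mu small, uniform convergence
   and the Lipschitz bound give g_mu(z, y) >= v(x) - 2d for all y in Y, and
   g_mu(z, y) <= v(x) + 2d for y in the intersection N of Y with a small ball
   centered at a minimizer of g(x, .). Hence v_mu(z) lies between
   v(x) - 2d - mu ln vol(Y) and v(x) + 2d - mu ln vol(N), and both logarithmic
   terms vanish with mu provided vol(N) > 0. The latter is where the convexity of
   Y is used: N contains a homothetic copy of Y. *)

(** * Lebesgue measure under homotheties *)

(** Scaling by [c] the pushforward of Lebesgue measure under [x |-> a + c * x] gives a measure that
    agrees with Lebesgue measure on half-open intervals, hence everywhere by uniqueness. *)
Lemma lebesgue_measure_affine (R : realType) (a c : R)
    (A : set (measurableTypeR R)) : 0 < c -> measurable A ->
  (c%:E * lebesgue_measure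
    ((fun x : measurableTypeR R => ((a + c * x)%R : measurableTypeR R)) @^-1` A) =
   lebesgue_measure A)%E.
Proof.
move=> c0 mA; pose f (x : measurableTypeR R) : measurableTypeR R := a + c * x.
have mf : measurable_fun [set: measurableTypeR R] f.
  apply: measurable_funD; first exact: measurable_cst.
  by apply: measurable_funM; [exact: measurable_cst|exact: measurable_id].
(* The measure structure of a pushforward depends on the proof [mf], which
   unification cannot find; hence the explicit instance. *)
pose nu : {measure set (measurableTypeR R) -> \bar R} :=
  mscale (NngNum (ltW c0))
    (measure_function_pushforward__canonical__measure_function_Measure
       lebesgue_measure mf).
rewrite [RHS](@lebesgue_measure_unique R nu) //= => _ [[u v] _ <-] /=.
rewrite /nu /mscale /= /pushforward.
rewrite (_ : f @^-1` _ = `]((u - a) / c), ((v - a) / c)]%classic); last first.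
  apply/seteqP; split => x /=; rewrite !in_itv /= /f ltr_pdivrMr // ler_pdivlMr //
    => /andP[h1 h2]; apply/andP; split; lra.
rewrite !lebesgue_measure_itv /= !lte_fin ltr_pM2r ?invr_gt0 // ltrD2r.
case: ifP => _; last by rewrite mule0.
by rewrite -!EFinD -EFinM; congr EFin; field; rewrite gt_eqF.
Qed.

Definition tuple_homothety {R : realType} {m : nat} (a : 'I_m -> R) (c : R)
    (t : m.-tuple (measurableTypeR R)) : m.-tuple (measurableTypeR R) :=
  [tuple a i + c * tnth t i | i < m].

Lemma measurable_tuple_homothety (R : realType) (m : nat) (a : 'I_m -> R) (c : R) :
  measurable_fun setT (tuple_homothety a c).
Proof.
apply/measurable_fun_tnthP => i.
rewrite (_ : _ \o _ = fun t => (a i + c * tnth t i : measurableTypeR R)); last first.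
  by apply/funext => t /=; rewrite tnth_mktuple.
apply: measurable_funD; first exact: measurable_cst.
by apply: measurable_funM; [exact: measurable_cst|exact: measurable_tnth].
Qed.

(** Induction on the dimension, slicing along the first coordinate: that coordinate is handled by a
    one-dimensional change of variable, and each slice by the induction hypothesis. Each contributes
    its share of the factor [c ^+ m]. *)
Lemma lebesgue_tuple_homothety (R : realType) (m : nat) (a : 'I_m -> R) (c : R)
    (A : set (m.-tuple (measurableTypeR R))) : 0 < c -> measurable A ->
  ((c ^+ m)%:E * lebesgue_tuple R m (tuple_homothety a c @^-1` A) =
   lebesgue_tuple R m A)%E.
Proof.
move=> c0; elim: m a A => [|m IH] a A mA.
  rewrite expr0 mul1e; congr (lebesgue_tuple R 0 _).
  by apply/seteqP; split => t /=;
    rewrite (tuple0 t) (tuple0 (tuple_homothety a c [tuple])).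
pose f (x : measurableTypeR R) : measurableTypeR R := a ord0 + c * x.
have mf : measurable_fun [set: measurableTypeR R] f.
  apply: measurable_funD; first exact: measurable_cst.
  by apply: measurable_funM; [exact: measurable_cst|exact: measurable_id].
pose B := @cons_pair R m @^-1` A.
have mB : measurable B.
  by rewrite -[B]setTI; apply: measurable_cons_pair.
have mphi : measurable_fun setT (lebesgue_tuple R m \o xsection B).
  exact: measurable_fun_xsection.
pose nu : {measure set (measurableTypeR R) -> \bar R} :=
  mscale (NngNum (ltW c0))
    (measure_function_pushforward__canonical__measure_function_Measure
       lebesgue_measure mf).
rewrite /= /lebesgue_cons /pushforward /product_measure1.
(* Replacing Lebesgue measure by [nu] in the outer integral on the right brings out one factor [c]
   and turns the slice at [x] into the slice at [f x]. *)
rewrite -/B [RHS](@eq_measure_integral _ _ _ _ nu); last first.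
  by move=> C mC _; rewrite /= /nu /mscale /= /pushforward lebesgue_measure_affine.
rewrite ge0_integral_mscale //= ge0_integral_pushforward //= preimage_setT.
rewrite exprS EFinM -muleA; congr *%E.
have cm0 : (0 <= (c ^+ m)%:E)%E by rewrite lee_fin exprn_ge0 // ltW.
have mB' : measurable (@cons_pair R m @^-1` (tuple_homothety a c @^-1` A)).
  rewrite -[X in measurable X]setTI; apply: measurable_cons_pair => //.
  by rewrite -[X in measurable X]setTI; apply: measurable_tuple_homothety.
have mphi' := @measurable_fun_xsection _ _ _ _ _ (lebesgue_tuple R m) _ mB'.
rewrite -ge0_integralZl //.
apply: eq_integral => x _ /=.
rewrite -[RHS](IH (fun i => a (lift ord0 i))); last exact: measurable_xsection.
congr (_ * lebesgue_tuple R m _)%E.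
apply/seteqP; split => t /=; rewrite /xsection /= !inE /B /=;
  (rewrite (_ : tuple_homothety a c _ =
    cons_pair (f x, tuple_homothety (fun i => a (lift ord0 i)) c t)) //;
  apply: eq_from_tnth => i; rewrite tnth_mktuple;
  have [j ->|->] := unliftP ord0 i; rewrite ?tnthS ?tnth_mktuple //).
Qed.

(** * Integrals of continuous functions over compact sets *)

(** Links the topology of row vectors to the product sigma-algebra of tuples: [O] is the countable
    union of the open cubes with rational centre and radius that it contains, and a cube is a finite
    intersection of coordinate conditions. [F] replaces the other cubes by the empty set. *)
Lemma measurable_rV_open (R : realType) (m : nat) (O : set 'rV[R]_m) :
  open O -> measurable (@rV_of_tuple R m @^-1` O).
Proof.
move=> oO.
pose S (p : 'rV[rat]_m * rat) := [set v : 'rV[R]_m |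
  forall i, `|v ord0 i - ratr (p.1 ord0 i)| < ratr p.2].
pose F p := if `[< S p `<=` O >] then S p else set0.
have -> : O = \bigcup_p F p.
  apply/seteqP; split => [v Ov|v [p _]]; last first.
    by rewrite /F; case: asboolP => // SO /SO.
  have /nbhs_ballP[e /= e0 eO] : nbhs v O by exact: open_nbhs_nbhs.
  (* Two points of a cube of radius [r] are less than [2 * r < e] apart; the lower bound [e / 4]
     keeps [r] positive. *)
  have [r] : exists r : rat, ratr r \in `](e / 4), (e / 2)[.
    by have [|r ?] := @rat_in_itvoo R (e / 4) (e / 2); [lra|exists r].
  rewrite in_itv /= => /andP[r1 r2].
  have /fin_all_exists[q qv] (i : 'I_m) : exists q : rat, `|v ord0 i - ratr q| < ratr r.
    have [|q] := @rat_in_itvoo R (v ord0 i - ratr r) (v ord0 i + ratr r); first lra.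
    by rewrite in_itv /= => ?; exists q; rewrite distrC ltr_distl.
  exists (\row_i q i, r) => //; rewrite /F asboolT => [i|w Sw] /=.
    by rewrite mxE.
  apply: eO; split => // i j; rewrite ord1 -ball_normE /=.
  have := Sw j; rewrite /= mxE; have := qv j.
  rewrite ltr_distl => /andP[a1 a2]; rewrite ltr_distl => /andP[b1 b2].
  by rewrite ltr_distl; apply/andP; split; lra.
rewrite preimage_bigcup; apply: countable_bigcupT_measurable.
  exact: countableP.
move=> p; rewrite /F; case: asboolP => _; last by rewrite preimage_set0.
rewrite (_ : _ @^-1` _ = \bigcap_(i in [set: 'I_m])
    ((@tnth m R)^~ i @^-1` ball (ratr (p.1 ord0 i) : R) (ratr p.2))).
  apply: fin_bigcap_measurable => // i _.
  rewrite -[X in measurable X]setTI.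
  by apply: measurable_tnth => //; exact: measurable_ball.
by apply/seteqP; split => [t St i _|t St i]; have := St i;
  rewrite /= -ball_normE /= mxE distrC //; exact.
Qed.

Lemma measurable_rV_compact (R : realType) (m : nat) (Y : set 'rV[R]_m) :
  compact Y -> measurable (@rV_of_tuple R m @^-1` Y).
Proof.
move=> /(compact_closed (@norm_hausdorff _ _)) cY.
rewrite -[Y]setCK preimage_setC; apply: measurableC.
rewrite -[X in measurable X]/(@rV_of_tuple R m @^-1` (~` Y)).
by apply: measurable_rV_open; rewrite openC.
Qed.

Lemma rV_coord_le_norm (R : realType) (m : nat) (v : 'rV[R]_m) i :
  `|v ord0 i| <= `|v|.
Proof.
rewrite -[leRHS]/(mx_norm v) mx_normrE; apply/bigmax_geP; right => /=.
by exists (ord0, i).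
Qed.

(** A compact set is bounded, so it lies in a cube, whose measure [lebesgue_tuple_box] computes. *)
Lemma lebesgue_tuple_compact_lty (R : realType) (m : nat) (Y : set 'rV[R]_m) :
  compact Y -> (lebesgue_tuple R m (@rV_of_tuple R m @^-1` Y) < +oo)%E.
Proof.
move=> cY; have [M [_ MY]] := compact_bounded cY.
(* [compact_bounded] gives bounds strictly above [M] only, and [M] may be negative. *)
pose N := `|M| + 1; have ge0N : - N <= N by rewrite ge0_cp // /N addr_ge0.
have NY v : Y v -> `|v| <= N.
  by move=> Yv; apply: MY => //; rewrite /N ltr_pwDr // ler_norm.
pose Q := [set v : 'rV[R]_m | forall i, v ord0 i \in `[(- N), N]].
have cQ : compact Q.
  apply: (@rV_compact _ _ (fun=> `[(- N), N]%classic)).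
  by move=> _; apply: segment_compact.
apply: (@le_lt_trans _ _ (lebesgue_tuple R m (@rV_of_tuple R m @^-1` Q))).
  apply: le_measure; rewrite ?inE; [exact: measurable_rV_compact..|].
  move=> t /NY tN i; rewrite /= in_itv /= -ler_norml.
  exact: le_trans (rV_coord_le_norm _ _) tN.
have := @lebesgue_tuple_box R m (fun=> - N) (fun=> N) (fun=> ge0N).
rewrite (_ : [set t | _] = @rV_of_tuple R m @^-1` Q).
  by move=> ->; rewrite ltry.
by apply/seteqP; split => t h i; have := h i; rewrite /= in_itv mxE.
Qed.

(** The preimage in [Y] of an open interval is the trace on [Y] of an open set, and open intervals
    generate the Borel sets. *)
Lemma measurable_fun_rV_within (R : realType) (m : nat) (Y : set 'rV[R]_m)
    (phi : 'rV[R]_m -> R) : compact Y -> {within Y, continuous phi} ->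
  measurable_fun (@rV_of_tuple R m @^-1` Y) (phi \o @rV_of_tuple R m).
Proof.
move=> cY /continuousP cphi; apply: (measurability _ (RGenOpens.measurableE R)).
move=> _ [_ [a [b ->] <-]].
have /cphi/open_subspaceP[V oV VY] : open (`]a, b[%classic : set R).
  exact: interval_open.
rewrite (_ : _ `&` _ = @rV_of_tuple R m @^-1` V `&` @rV_of_tuple R m @^-1` Y).
  by apply: measurableI; [exact: measurable_rV_open|exact: measurable_rV_compact].
by rewrite -preimage_setI VY setIC.
Qed.

Lemma integrable_rV_within (R : realType) (m : nat) (Y : set 'rV[R]_m)
    (phi : 'rV[R]_m -> R) : compact Y -> {within Y, continuous phi} ->
  (lebesgue_tuple R m).-integrable (@rV_of_tuple R m @^-1` Y)
    (EFin \o (phi \o @rV_of_tuple R m)).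
Proof.
move=> cY cphi; apply: measurable_bounded_integrable.
- exact: measurable_rV_compact.
- exact: lebesgue_tuple_compact_lty.
- exact: measurable_fun_rV_within.
have [M [Mr MY]] := compact_bounded (continuous_compact cphi cY).
exists M; split => // N MN t Yt; apply: MY MN _ _.
by exists (rV_of_tuple t).
Qed.

(** * Differentiation under the integral sign *)

(** Unfolds the little-o condition into an epsilon estimate, the form that bounds on integrals
    provide. *)
Lemma is_diff_linear_approx (R : realType) (V : normedModType R) (f : V -> R)
    (x : V) (L : {linear V -> R}) : continuous L ->
  (forall e, 0 < e ->
    \forall h \near (0 : V), `|f (x + h) - f x - L h| <= e * `|h|) ->
  is_diff x f L.
Proof.
move=> cL fL.
have fLo : f \o shift x = cst (f x) + L +o_ (0 : V) id.
  apply/eqaddoP => e e0; have := fL e e0; apply: filterS => h.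
  suff -> : (f \o shift x - (cst (f x) + L)) h = f (x + h) - f x - L h by [].
  by rewrite !fctE /= [h + x]addrC opprD addrA.
have dfE := diff_unique cL fLo.
by apply: DiffDef => //; apply/diff_locallyP; rewrite dfE; split.
Qed.

Lemma is_derive_line (R : realType) (V : normedModType R) (f : V -> R)
    (x u : V) (c : R) : differentiable f (x + c *: u) ->
  is_derive c 1 (fun r => f (x + r *: u)) ('d f (x + c *: u) u).
Proof.
move=> df; pose l (r : R) : V := x + r *: u.
have dl : is_diff c l ( *:%R ^~ u).
  rewrite -[( *:%R ^~ u)]add0r -[l]/(cst x + ( *:%R ^~ u)).
  exact: is_diffD.
have dfl : is_diff c (f \o l) ('d f (l c) \o ( *:%R ^~ u)).
  apply: is_diff_comp.
  exact/differentiableP.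
apply: DeriveDef.
  exact/derivable1_diffP.
rewrite deriveE; last exact: ex_diff.
by rewrite diff_val /= scale1r.
Qed.

(** By the mean value theorem along the segment, the increment is the derivative in direction [u] at
    an intermediate point. The remainder is thus as uniform as the bound on the derivative. *)
Lemma mean_value_diff (R : realType) (V : normedModType R) (f : V -> R)
    (x u : V) (l e : R) :
  (forall r : R, 0 <= r <= 1 -> differentiable f (x + r *: u)) ->
  (forall r : R, 0 <= r <= 1 -> `|'d f (x + r *: u) u - l| <= e) ->
  `|f (x + u) - f x - l| <= e.
Proof.
move=> df fl.
have dg (r : R) : 0 <= r <= 1 ->
    is_derive r 1 (fun s => f (x + s *: u)) ('d f (x + r *: u) u).
  by move=> r01; apply: is_derive_line; exact: df.
have [r|r r01|c + ] := @MVT_segment R (fun s => f (x + s *: u))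
    (fun r => 'd f (x + r *: u) u) 0 1 ler01.
- by rewrite in_itv /= => /andP[r0 r1]; apply: dg; rewrite !ltW.
- apply: continuous_in_subspaceT => s; rewrite inE /= in_itv /= => s01.
  apply: differentiable_continuous; apply/derivable1_diffP.
  exact: (@ex_derive _ _ _ _ _ _ _ (dg s s01)).
by rewrite in_itv /= => c01; rewrite subr0 mulr1 scale1r scale0r addr0 => ->;
  exact: fl.
Qed.

(** * Uniformity of derivatives over a compact set of parameters *)

Section C1_compact.
Context (R : realType) (V W : normedModType R) (O : set (V * W)) (K : set W).
Context (f : V * W -> R) (x : V).
Hypotheses (openO : open O) (compactK : compact K).
Hypotheses (C1f : continuously_differentiable_on O f).
Hypothesis (KO : forall y, K y -> O (x, y)).

(** The tube lemma, from the near-covering form of compactness. *)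
Lemma near_slice_open : \forall x' \near x, forall y, K y -> O (x', y).
Proof.
have /compact_near_coveringP cK := compactK.
apply: (cK _ (nbhs x) (fun x' y => O (x', y)) _) => y Ky.
have /= : \forall z \near (x, y), O z by apply: open_nbhs_nbhs; split => //; exact: KO.
case=> -[U1 U2] /= [xU1 yU2] U12; exists (U2, U1) => //= -[y' x'] [/= ? ?].
exact: U12.
Qed.

Lemma near_diff_uniform e : 0 < e ->
  \forall x' \near x, forall y, K y ->
    forall h, `|'d f (x', y) h - 'd f (x, y) h| <= e * `|h|.
Proof.
move=> e0; have /compact_near_coveringP cK := compactK.
apply: (cK _ (nbhs x) (fun x' y => forall h,
  `|'d f (x', y) h - 'd f (x, y) h| <= e * `|h|) _) => y Ky.
(* For [y'] close to [y], the derivatives at [(x', y')] and [(x, y')] are both compared with the one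
   at [(x, y)], at a cost of [e / 2] each. *)
have [_ /(_ _ (KO Ky) (e / 2))] := C1f.
rewrite divr_gt0 // => /(_ isT).
case=> -[U1 U2] /= [xU1 yU2] U12; exists (U2, U1) => //= -[y' x'] [/= y'U x'U] h.
have h1 := U12 (x', y') (conj x'U y'U) h.
have h2 := U12 (x, y') (conj (nbhs_singleton xU1) y'U) h.
rewrite (le_trans (ler_distD ('d f (x, y) h) _ _)) // (splitr e) mulrDl.
apply: lerD h1 _; rewrite distrC; exact: h2.
Qed.

(** If [k] bounds the derivative at [(x, y)], then by continuity [k + 1] bounds it at [(x, y')] for
    [y'] near [y]. Near-covering along the filter at infinity turns these local bounds into a single
    one. *)
Lemma diff_uniform_bound : exists2 M, 0 < M &
  forall y, K y -> forall h, `|'d f (x, y) h| <= M * `|h|.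
Proof.
have /compact_near_coveringP cK := compactK.
suff /pinfty_ex_gt0[M M0 MK] : \forall M \near +oo, K `<=`
    (fun y => forall h, `|'d f (x, y) h| <= M * `|h|) by exists M.
apply: (cK _ (+oo) (fun M y => forall h, `|'d f (x, y) h| <= M * `|h|) _) => y Ky.
have [df /(_ _ (KO Ky) 1 ltr01)] := C1f.
have [k k0 kf] := linear_lipschitz (diff_continuous (df _ (KO Ky))).
case=> -[U1 U2] /= [xU1 yU2] U12.
exists (U2, [set M | k + 1 < M]).
  split => //=; by apply: nbhs_pinfty_gt; exact: num_real.
move=> [y' M] [/= y'U kM] h.
have h2 := U12 (x, y') (conj (nbhs_singleton xU1) y'U) h.
apply: (@le_trans _ _ ((k + 1) * `|h|)); last by rewrite ler_wpM2r // ltW.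
rewrite mulrDl -(subrK ('d f (x, y) h) ('d f (x, y') h)) addrC.
by rewrite (le_trans (ler_normD _ _)) // lerD.
Qed.

Lemma diff_slice_continuous h : {within K, continuous (fun y => 'd f (x, y) h)}.
Proof.
apply: continuous_in_subspaceT => y; rewrite inE => Ky.
apply/cvgrPdist_le => e e0.
(* Dividing by this rather than by the norm of [h] covers [h = 0]. *)
have h0 : 0 < `|h| + 1 by rewrite ltr_wpDl.
have [_ /(_ _ (KO Ky) (e / (`|h| + 1)))] := C1f.
rewrite divr_gt0 // => /(_ isT).
case=> -[U1 U2] /= [xU1 yU2] U12.
apply: filterS yU2 => y' y'U; rewrite distrC.
have /le_trans := U12 (x, y') (conj (nbhs_singleton xU1) y'U) h; apply.
by rewrite mulrAC ler_pdivrMr // ler_pM2l // lerDl.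
Qed.

Lemma slice_continuous : {within K, continuous (fun y => f (x, y))}.
Proof.
apply: continuous_in_subspaceT => y; rewrite inE => Ky.
have [/(_ _ (KO Ky))/differentiable_continuous cf _] := C1f.
apply: (@continuous_comp _ _ _ (fun y => (x, y)) f) => //.
by apply: cvg_pair; [exact: cvg_cst|exact: cvg_id].
Qed.

End C1_compact.

Lemma within_continuousB (R : realType) (T : topologicalType) (A : set T)
    (phi psi : T -> R) : {within A, continuous phi} -> {within A, continuous psi} ->
  {within A, continuous (fun y => phi y - psi y)}.
Proof. by move=> c1 c2 y; apply: continuousB; [exact: c1|exact: c2]. Qed.

(** * The real-valued integral over a compact set *)

Section rV_integral.
Context (R : realType) (m : nat) (Y : set 'rV[R]_m).
Hypothesis compactY : compact Y.
Implicit Types phi psi : 'rV[R]_m -> R.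

Definition rV_integral phi : R :=
  \int[lebesgue_tuple R m]_(t in @rV_of_tuple R m @^-1` Y) phi (rV_of_tuple t).

Let mY := measurable_rV_compact compactY.

Lemma rV_integral_linear a phi psi :
  {within Y, continuous phi} -> {within Y, continuous psi} ->
  rV_integral (fun y => a * phi y + psi y) = a * rV_integral phi + rV_integral psi.
Proof.
move=> /(integrable_rV_within compactY) iphi /(integrable_rV_within compactY) ipsi.
rewrite /rV_integral RintegralD ?RintegralZl //.
rewrite (_ : EFin \o _ = fun t => (a%:E * (EFin \o (phi \o @rV_of_tuple R m)) t)%E) //.
exact: integrableZl.
Qed.

Lemma rV_integralB phi psi :
  {within Y, continuous phi} -> {within Y, continuous psi} ->
  rV_integral (fun y => phi y - psi y) = rV_integral phi - rV_integral psi.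
Proof.
move=> /(integrable_rV_within compactY) iphi /(integrable_rV_within compactY) ipsi.
exact: RintegralB.
Qed.

Lemma rV_integral_cst a :
  rV_integral (cst a) = a * fine (lebesgue_tuple R m (@rV_of_tuple R m @^-1` Y)).
Proof. exact: Rintegral_cst. Qed.

Lemma le_rV_integral phi psi :
  {within Y, continuous phi} -> {within Y, continuous psi} ->
  (forall y, Y y -> phi y <= psi y) -> rV_integral phi <= rV_integral psi.
Proof.
move=> /(integrable_rV_within compactY) iphi /(integrable_rV_within compactY) ipsi pp.
by apply: le_Rintegral => // t Yt; exact: pp.
Qed.

Lemma norm_rV_integral_le a phi : {within Y, continuous phi} ->
  (forall y, Y y -> `|phi y| <= a) ->
  `|rV_integral phi| <= a * fine (lebesgue_tuple R m (@rV_of_tuple R m @^-1` Y)).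
Proof.
move=> cphi phia; have ccst b : {within Y, continuous (cst b : 'rV[R]_m -> R)}.
  exact/continuous_subspaceT/cst_continuous.
rewrite ler_norml -mulNr -!rV_integral_cst.
by apply/andP; split; apply: le_rV_integral => // y /phia; rewrite ler_norml => /andP[].
Qed.

End rV_integral.

(** * Integrals depending on a parameter *)

Section diff_rV_integral.
Context (R : realType) (V : normedModType R) (m : nat).
Context (O : set (V * 'rV[R]_m)) (Y : set 'rV[R]_m) (f : V * 'rV[R]_m -> R).
Hypotheses (openO : open O) (compactY : compact Y).
Hypothesis (C1f : continuously_differentiable_on O f).

Lemma norm_pair0 (h : V) : `|(h, 0 : 'rV[R]_m)| = `|h|.
Proof. by rewrite prod_normE /= normr0 max_l. Qed.

(** The remainder of the integral is the integral of the remainders of the slices. The mean value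
    estimate bounds each of these by a small multiple of the norm of [h], uniformly in [y]. *)
Lemma is_diff_rV_integral x : (forall y, Y y -> O (x, y)) ->
  is_diff x (fun x' => rV_integral Y (fun y => f (x', y)))
    (fun h => rV_integral Y (fun y => 'd f (x, y) (h, 0))).
Proof.
move=> YO.
set vol := fine (lebesgue_tuple R m (@rV_of_tuple R m @^-1` Y)).
have vol0 : 0 <= vol by rewrite fine_ge0 // measure_ge0.
pose L (h : V) : R := rV_integral Y (fun y => 'd f (x, y) (h, 0)).
have cdf h : {within Y, continuous (fun y => 'd f (x, y) (h, 0))}.
  exact: diff_slice_continuous C1f YO _.
have linL : linear L.
  move=> a h k; rewrite /L -rV_integral_linear //; congr rV_integral.
  apply/funext => y.
  rewrite (_ : (a *: h + k, 0) = a *: (h, 0) + (k, 0) :> V * 'rV[R]_m) ?linearP //.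
  by congr pair; rewrite /= scaler0 addr0.
pose Llin := GRing.isLinear.Build _ _ _ _ _ linL.
pose Lf : {linear V -> R} := HB.pack L Llin.
rewrite -/L -[L]/(Lf : _ -> _).
(* Continuity of the candidate derivative comes first: it is linear, and bounded because the
   derivatives of [f] are bounded uniformly over [Y]. *)
apply: is_diff_linear_approx.
  have [M M0 fM] := diff_uniform_bound compactY C1f YO.
  apply/bounded_linear_continuous/linear_boundedP.
  near=> r => h.
  have /le_trans -> // : `|Lf h| <= (M * `|h|) * vol.
    apply: norm_rV_integral_le => // y Yy.
    by rewrite -(norm_pair0 h); exact: fM.
  rewrite mulrAC ler_wpM2r //; near: r; apply: nbhs_pinfty_ge; exact: num_real.
(* Integration over [Y] multiplies a uniform bound by [vol]; adding 1 covers [vol = 0]. *)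
move=> e e0; pose d := e / (vol + 1).
have d0 : 0 < d by rewrite divr_gt0 // ltr_wpDl.
have vold : d * vol <= e.
  by rewrite mulrAC ler_pdivrMr ?ltr_wpDl // ler_pM2l // lerDl.
have : nbhs x [set x' | (forall y, Y y -> O (x', y)) /\
    forall y, Y y -> forall h, `|'d f (x', y) h - 'd f (x, y) h| <= d * `|h|].
  apply: filterI; first exact: near_slice_open.
  exact: near_diff_uniform C1f YO _ d0.
move=> /nbhs_ballP[r /= r0 xr]; near=> h.
have hr : `|h| < r by near: h; exact: nbhs0_lt.
(* The mean value estimate needs the whole segment from [x] to [x + h] inside the ball where the
   derivatives are controlled. *)
have xsh (s : R) : 0 <= s <= 1 -> ball x r (x + s *: h).
  move=> /andP[s0 s1]; rewrite -ball_normE /= opprD addNKr normrN normrZ ger0_norm //.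
  by rewrite (le_lt_trans _ hr) // ler_piMl.
have xh : ball x r (x + h) by rewrite -[h]scale1r; apply: xsh; rewrite ler01 lexx.
have [YOh _] := xr _ xh.
have cf := slice_continuous C1f YO; have cfh := slice_continuous C1f YOh.
rewrite /= /L -!rV_integralB //; last exact: within_continuousB.
apply: (@le_trans _ _ (d * `|h| * vol)); last first.
  by rewrite mulrAC ler_wpM2r.
apply: norm_rV_integral_le => //; first by do 2?apply: within_continuousB.
move=> y Yy.
have xyE (s : R) : (x, y) + s *: (h, 0) = (x + s *: h, y).
  by congr pair; rewrite /= scaler0 addr0.
rewrite (_ : (x + h, y) = (x, y) + (h, 0)); last by congr pair; rewrite /= addr0.
apply: mean_value_diff => s /xsh/xr[YOs dfs]; rewrite xyE.
  by have [df _] := C1f; exact/df/YOs.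
by rewrite -(norm_pair0 h); exact: dfs.
Unshelve. all: by end_near. Qed.

(** The derivatives of the integral at two points differ by the integral of the differences of the
    derivatives of [f], which are small uniformly in [y]. *)
Lemma continuously_differentiable_rV_integral (Q : set V) :
  (forall x y, Q x -> Y y -> O (x, y)) ->
  continuously_differentiable_on Q (fun x => rV_integral Y (fun y => f (x, y))).
Proof.
move=> QO; split=> x Qx.
  exact: (@ex_diff _ _ _ _ _ _ _ (is_diff_rV_integral (fun y => QO x y Qx))).
move=> e e0.
set vol := fine (lebesgue_tuple R m (@rV_of_tuple R m @^-1` Y)).
have vol0 : 0 <= vol by rewrite fine_ge0 // measure_ge0.
pose d := e / (vol + 1).
have d0 : 0 < d by rewrite divr_gt0 // ltr_wpDl.
have vold : d * vol <= e.
  by rewrite mulrAC ler_pdivrMr ?ltr_wpDl // ler_pM2l // lerDl.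
have YO y : Y y -> O (x, y) by exact: QO.
have := near_diff_uniform compactY C1f YO d0.
have := near_slice_open openO compactY YO.
apply: filterS2 => x' YO' dx' h.
rewrite (@diff_val _ _ _ _ _ _ _ (is_diff_rV_integral YO)).
rewrite (@diff_val _ _ _ _ _ _ _ (is_diff_rV_integral YO')).
have cdf := @diff_slice_continuous _ _ _ _ _ _ _ C1f YO (h, 0).
have cdf' := @diff_slice_continuous _ _ _ _ _ _ _ C1f YO' (h, 0).
rewrite -(rV_integralB compactY cdf' cdf).
apply: (@le_trans _ _ (d * `|h| * vol)); last first.
  by rewrite mulrAC ler_wpM2r.
apply: norm_rV_integral_le => //; first exact: within_continuousB cdf' cdf.
move=> y Yy.
by rewrite -(norm_pair0 h); exact: dx'.
Qed.

End diff_rV_integral.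

(** By the chain rule the derivative at [y] is ['d phi y] times the scalar [dpsi (phi y)], and both
    factors are continuous in [y]. *)
Lemma continuously_differentiable_comp (R : realType) (V : normedModType R)
    (O : set V) (phi : V -> R) (psi dpsi : R -> R) :
  continuously_differentiable_on O phi ->
  (forall x, O x -> \forall y \near x, is_derive (phi y) 1 psi (dpsi (phi y))) ->
  (forall x, O x -> {for phi x, continuous dpsi}) ->
  open O -> continuously_differentiable_on O (psi \o phi).
Proof.
move=> [dphi cphi] dpsiE cdpsi oO.
have diffE y : differentiable phi y -> is_derive (phi y) 1 psi (dpsi (phi y)) ->
    is_diff y (psi \o phi) (fun h => 'd phi y h * dpsi (phi y)).
  move=> dy dpsiy.
  have d1 : derivable psi (phi y) 1 by exact: (@ex_derive _ _ _ _ _ _ _ dpsiy).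
  have d2 : differentiable psi (phi y) by exact/derivable1_diffP.
  apply: DiffDef; first exact: differentiable_comp.
  rewrite diff_comp // deriv1E // derive1E.
  by rewrite (@derive_val _ _ _ _ _ _ _ dpsiy).
split=> x Ox.
  apply: (@ex_diff _ _ _ _ _ _ _ (diffE x (dphi x Ox) _)).
  exact: nbhs_singleton (dpsiE x Ox).
move=> e e0.
have [k k0 kphi] := linear_lipschitz (diff_continuous (dphi x Ox)).
have C0 : 0 < `|dpsi (phi x)| + 1 by rewrite ltr_wpDl.
have cphix : phi @ x --> phi x by exact: differentiable_continuous (dphi x Ox).
have cdp : (dpsi \o phi) @ x --> dpsi (phi x).
  exact: cvg_comp cphix (cdpsi x Ox).
near=> y => h.
have Oy : O y by near: y; exact: open_nbhs_nbhs.
have dpy : is_derive (phi y) 1 psi (dpsi (phi y)) by near: y; exact: dpsiE.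
have dpx := nbhs_singleton (dpsiE x Ox).
rewrite (@diff_val _ _ _ _ _ _ _ (diffE y (dphi y Oy) dpy)).
rewrite (@diff_val _ _ _ _ _ _ _ (diffE x (dphi x Ox) dpx)).
have h1 : `|'d phi y h - 'd phi x h| <= e / 2 / (`|dpsi (phi x)| + 1) * `|h|.
  by move: h; near: y; apply: cphi => //; rewrite !divr_gt0.
(* The bound 1 controls the size of [dpsi (phi y)]; the bound [e / 2 / k] makes the term carrying
   the variation of [dpsi] small. *)
have h2 : `|dpsi (phi x) - dpsi (phi y)| <= Num.min 1 (e / 2 / k).
  near: y; move/cvgrPdist_le : cdp; apply.
  by rewrite lt_min ltr01 !divr_gt0.
move: h2; rewrite le_min => /andP[h2 h3].
have h4 : `|dpsi (phi y)| <= `|dpsi (phi x)| + 1.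
  rewrite -[dpsi (phi y)](subrK (dpsi (phi x))) addrC.
  by rewrite (le_trans (ler_normD _ _)) // lerD2l distrC.
have h5 := kphi h.
move: h1 h2 h3 h4 h5; move: ('d phi y h) ('d phi x h) (dpsi (phi y)) (dpsi (phi x)) (C0).
move=> a b p q q0 h1 h2 h3 h4 h5.
(* The first term is small by continuity of the derivative of [phi], the second by continuity of
   [dpsi]. *)
rewrite (_ : a * p - b * q = (a - b) * p - b * (q - p)); last by ring.
rewrite (le_trans (ler_normB _ _)) // !normrM (splitr e) mulrDl lerD //.
  apply: (@le_trans _ _ (e / 2 / (`|q| + 1) * `|h| * (`|q| + 1))).
    by rewrite ler_pM.
  by rewrite mulrAC divfK // gt_eqF.
apply: (@le_trans _ _ (k * `|h| * (e / 2 / k))); first by rewrite ler_pM.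
by rewrite mulrC mulrA divfK // gt_eqF.
Unshelve. all: by end_near. Qed.

(** * Laplace's method *)

Lemma near_dist_le (R : realType) (V : normedModType R) (x : V) (d : R) :
  0 < d -> \forall y \near x, `|x - y| <= d.
Proof.
by move=> d0; apply: filterS (nbhsx_ballx x d d0) => y; rewrite -ball_normE => /ltW.
Qed.

Lemma rV_of_tuple_homothety (R : realType) (m : nat) (u : 'rV[R]_m) (c : R) t :
  rV_of_tuple (tuple_homothety (fun i => u ord0 i) c t) = u + c *: rV_of_tuple t.
Proof. by apply/rowP => i; rewrite !mxE tnth_mktuple. Qed.

(* A homothety of small ratio centered at [y0] maps the convex set [Y] into its
   intersection with the ball, and it scales the measure by a positive factor. *)
Lemma lebesgue_tuple_convex_ball_gt0 (R : realType) (m : nat) (Y : set 'rV[R]_m)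
    (y0 : 'rV[R]_m) (r : R) : compact Y -> convex_set Y -> Y y0 -> 0 < r ->
  (0 < lebesgue_tuple R m (@rV_of_tuple R m @^-1` Y))%E ->
  (0 < lebesgue_tuple R m (@rV_of_tuple R m @^-1` (Y `&` closed_ball y0 r)))%E.
Proof.
move=> cY convY Yy0 r0 Y0.
have [M [_ MY]] := compact_bounded cY.
pose B := `|M| + 1.
have YB y : Y y -> `|y| <= B.
  by move=> Yy; apply: MY => //; rewrite /B ltr_pwDr // ler_norm.
have B0 : 0 < B by rewrite /B ltr_wpDl.
(* A ratio at most 1 keeps the image in [Y] by convexity. As points of [Y] are at most [2 * B]
   apart, the other bound keeps the image within [r] of [y0]. *)
pose c := Num.min 1 (r / (2 * B)).
have c0 : 0 < c by rewrite lt_min ltr01 divr_gt0 // mulr_gt0.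
have c1 : c <= 1 by rewrite ge_min lexx.
have cB : c * (2 * B) <= r.
  by rewrite -ler_pdivlMr ?mulr_gt0 // /c ge_min lexx orbT.
(* With this translation, [y |-> u + c *: y] fixes [y0]. *)
pose u := (1 - c) *: y0.
have mN : measurable (@rV_of_tuple R m @^-1` (Y `&` closed_ball y0 r)).
  apply: measurable_rV_compact; apply: compact_closedI => //.
  exact: closed_ball_closed.
rewrite -(lebesgue_tuple_homothety (fun i => u ord0 i) c0 mN).
rewrite mule_gt0 ?lte_fin ?exprn_gt0 //.
apply: (lt_le_trans Y0); apply: le_measure; rewrite ?inE.
- exact: measurable_rV_compact.
- rewrite -[X in measurable X]setTI; exact: measurable_tuple_homothety.
move=> t /= Yt; rewrite rV_of_tuple_homothety; set y := rV_of_tuple t in Yt *.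
split.
  have := convY y y0 (Itv01 (ltW c0) c1); rewrite !inE => /(_ Yt Yy0).
  by rewrite /u addrC.
rewrite closed_ballE // /closed_ball_ /= /u.
rewrite (_ : y0 - _ = c *: (y0 - y)); last first.
  by rewrite scalerBr scalerBl scale1r opprD opprB addrA subrKC.
rewrite normrZ gtr0_norm // (le_trans _ cB) // ler_pM2l //.
rewrite (le_trans (ler_normB _ _)) // mulr_natl mulr2n.
by rewrite lerD // YB.
Qed.

(** Applying [- mu * ln] reverses the inequality and splits the product: [a] survives unscaled,
    while the measure [A] only enters through a term proportional to [mu]. *)
Lemma le_ln_Laplace (R : realType) (mu a A F : R) : 0 < mu -> 0 < A ->
  expR (- mu^-1 * a) * A <= F -> - mu * ln F <= a - mu * ln A.
Proof.
move=> mu0 A0 AF.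
have F0 : 0 < F by rewrite (lt_le_trans _ AF) // mulr_gt0 // expR_gt0.
rewrite -ler_ln ?posrE // in AF; last by rewrite mulr_gt0 // expR_gt0.
rewrite lnM ?posrE ?expR_gt0 // expRK in AF.
move: AF; rewrite -(ler_pM2l mu0) mulrDr mulrA mulrN divff ?gt_eqF // mulN1r => AF; lra.
Qed.

Lemma ge_ln_Laplace (R : realType) (mu a A F : R) : 0 < mu -> 0 < A -> 0 < F ->
  F <= expR (- mu^-1 * a) * A -> a - mu * ln A <= - mu * ln F.
Proof.
move=> mu0 A0 F0 AF.
rewrite -ler_ln ?posrE // in AF; last by rewrite mulr_gt0 // expR_gt0.
rewrite lnM ?posrE ?expR_gt0 // expRK in AF.
move: AF; rewrite -(ler_pM2l mu0) mulrDr mulrA mulrN divff ?gt_eqF // mulN1r => AF; lra.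
Qed.

(** * Minimizers and continuity of the value function *)

Section value_function_facts.
Context (R : realType) (n m : nat) (Y : set 'rV[R]_m).
Context (g : 'rV[R]_n * 'rV[R]_m -> R).
Hypotheses (compactY : compact Y) (Y0 : Y !=set0).

(** The extreme value theorem guarantees that [set_min], arbitrary in general, is a true minimum
    here. *)
Lemma value_function_attained x : {within Y, continuous (fun y => g (x, y))} ->
  exists2 y, Y y & value_function Y g x = g (x, y) /\
    forall y', Y y' -> value_function Y g x <= g (x, y').
Proof.
move=> cg; have [y /set_mem Yy ymin] := compact_EVT_min Y0 compactY cg.
have vE : value_function Y g x = g (x, y).
  apply: set_minE; first by exists y.
  by move=> _ [y' Yy' <-]; apply: ymin; rewrite inE.
by exists y => //; split => // y' Yy'; rewrite vE ymin // inE.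
Qed.

Lemma norm_pairB (x x' : 'rV[R]_n) (y y' : 'rV[R]_m) :
  `|(x, y) - (x', y')| = Num.max `|x - x'| `|y - y'|.
Proof. by rewrite prod_normE. Qed.

Lemma lipschitz_bound : lipschitz g ->
  exists2 k, 0 < k & forall p q, `|g p - g q| <= k * `|p - q|.
Proof.
move=> /pinfty_ex_gt0[k k0 gk]; exists k => // p q.
by apply: (gk (p, q)).
Qed.

Lemma lipschitz_continuous_slice x : lipschitz g ->
  {within Y, continuous (fun y => g (x, y))}.
Proof.
move=> /lipschitz_bound[k k0 gk]; apply: continuous_subspaceT => y.
apply/(@cvgrPdist_le _ _ _ (nbhs y)) => e e0; near=> y'.
rewrite (le_trans (gk _ _)) // norm_pairB subrr normr0 max_r //.
rewrite -ler_pdivlMl //; near: y'; apply: (@near_dist_le _ 'rV[R]_m).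
by rewrite mulr_gt0 // invr_gt0.
Unshelve. all: by end_near. Qed.

(** Testing [x] against a minimizer for [x'], and conversely, shows that the value function inherits
    the Lipschitz constant of [g]. *)
Lemma value_function_continuous : lipschitz g -> continuous (value_function Y g).
Proof.
move=> lipg; have [k k0 gk] := lipschitz_bound lipg.
have vle x x' : value_function Y g x <= value_function Y g x' + k * `|x - x'|.
  have [y Yy [_ xmin]] := value_function_attained (@lipschitz_continuous_slice x lipg).
  have [y' Yy' [-> _]] := value_function_attained (@lipschitz_continuous_slice x' lipg).
  rewrite (le_trans (xmin _ Yy')) //.
  have := gk (x, y') (x', y'); rewrite norm_pairB subrr normr0 max_l //.
  by rewrite ler_norml => /andP[_]; rewrite lerBlDl.
move=> x; apply/(@cvgrPdist_le _ _ _ (nbhs x)) => e e0; near=> x'.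
apply: (@le_trans _ _ (k * `|x - x'|)).
  have := vle x x'; have := vle x' x; rewrite [`|x' - x|]distrC => h1 h2.
  by rewrite ler_norml; apply/andP; split; lra.
rewrite -ler_pdivlMl //; near: x'; apply: (@near_dist_le _ 'rV[R]_n).
by rewrite mulr_gt0 // invr_gt0.
Unshelve. all: by end_near. Qed.

End value_function_facts.

(** * Comparison of integrals, and exponentials and logarithms of C^1 functions *)

Lemma rV_integral_subset (R : realType) (m : nat) (Y Z : set 'rV[R]_m)
    (phi : 'rV[R]_m -> R) : compact Y -> compact Z -> Z `<=` Y ->
  {within Y, continuous phi} -> (forall y, Y y -> 0 <= phi y) ->
  rV_integral Z phi <= rV_integral Y phi.
Proof.
move=> cY cZ ZY cphi phi0; have cphiZ := continuous_subspaceW ZY cphi.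
rewrite /rV_integral /Rintegral fine_le //.
- by apply: integrable_fin_num; [exact: measurable_rV_compact|exact: integrable_rV_within].
- by apply: integrable_fin_num; [exact: measurable_rV_compact|exact: integrable_rV_within].
apply: ge0_subset_integral.
- exact: measurable_rV_compact.
- exact: measurable_rV_compact.
- by apply/measurable_EFinP; exact: measurable_fun_rV_within.
- by move=> t /phi0; rewrite lee_fin.
- by move=> t /ZY.
Qed.

(** The function is bounded below by its minimum over [Y], a positive constant, and [Y] has positive
    finite measure. *)
Lemma rV_integral_gt0 (R : realType) (m : nat) (Y : set 'rV[R]_m)
    (phi : 'rV[R]_m -> R) : compact Y -> Y !=set0 ->
  (0 < lebesgue_tuple R m (@rV_of_tuple R m @^-1` Y))%E ->
  {within Y, continuous phi} -> (forall y, Y y -> 0 < phi y) ->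
  0 < rV_integral Y phi.
Proof.
move=> cY Y0 posY cphi phi0.
have [y /set_mem Yy ymin] := compact_EVT_min Y0 cY cphi.
apply: (@lt_le_trans _ _ (rV_integral Y (cst (phi y)))).
  rewrite rV_integral_cst // mulr_gt0 ?phi0 // fine_gt0 // posY.
  exact: lebesgue_tuple_compact_lty.
apply: le_rV_integral => //; first exact/continuous_subspaceT/cst_continuous.
by move=> y' Yy'; apply: ymin; rewrite inE.
Qed.

Lemma continuously_differentiable_expR (R : realType) (V : normedModType R)
    (O : set V) (phi : V -> R) (c : R) : open O ->
  continuously_differentiable_on O phi ->
  continuously_differentiable_on O (fun z => expR (c * phi z)).
Proof.
move=> oO C1phi.
apply: (@continuously_differentiable_comp _ _ _ _ (fun s => expR (c * s))
  (fun s => expR (c * s) * c) C1phi) => // z Oz.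
- near=> y; apply: (@is_derive1_comp _ expR (fun s => c * s)); first exact: is_derive_expR.
  exact: (is_derive_eq (is_deriveZ c (is_derive_id (phi y) (1 : R))) (mulr1 c)).
- apply: (@cvgM _ _ _ _ (fun s => expR (c * s)) (cst c)); last exact: cvg_cst.
  apply: (@continuous_comp _ _ _ (fun s => c * s) expR); last exact: continuous_expR.
  exact: mulrl_continuous.
Unshelve. all: by end_near. Qed.

Lemma continuously_differentiable_ln (R : realType) (V : normedModType R)
    (O : set V) (phi : V -> R) (c : R) : open O ->
  (forall z, O z -> 0 < phi z) ->
  continuously_differentiable_on O phi ->
  continuously_differentiable_on O (fun z => c * ln (phi z)).
Proof.
move=> oO phi0 C1phi.
apply: (@continuously_differentiable_comp _ _ _ _ (fun s => c * ln s)
  (fun s => c * s^-1) C1phi) => // z Oz.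
- near=> y; apply: (@is_deriveZ R R R (@ln R) c (phi y) 1); apply: is_derive1_ln.
  by apply: phi0; near: y; exact: open_nbhs_nbhs.
- apply: (@cvgM _ _ _ _ (cst c) (fun s => s^-1)); first exact: cvg_cst.
  by apply: cvgV; [rewrite gt_eqF // phi0|exact: cvg_id].
Unshelve. all: by end_near. Qed.

Lemma near0_mulr_le (R : realType) (c e : R) : 0 < e ->
  \forall mu \near 0^'+, `|mu * c| <= e.
Proof.
move=> e0; have C0 : 0 < `|c| + 1 by rewrite ltr_wpDl.
near=> mu.
have mu0 : 0 < mu by near: mu; exact: nbhs_right_gt.
have mue : mu <= e / (`|c| + 1).
  by near: mu; apply: nbhs_right_le; rewrite divr_gt0.
rewrite normrM gtr0_norm // (le_trans (ler_wpM2r _ mue)) //.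
by rewrite mulrAC ler_pdivrMr // ler_pM2l // lerDl.
Unshelve. all: by end_near. Qed.

Lemma open_setX (S T : topologicalType) (A : set S) (B : set T) :
  open A -> open B -> open (A `*` B).
Proof.
move=> oA oB; rewrite openE => -[x y] [/= Ax By].
by exists (A, B) => //; split; exact: open_nbhs_nbhs.
Qed.

Lemma lebesgue_tuple_gt0_nonempty (R : realType) (m : nat) (Y : set 'rV[R]_m) :
  (0 < lebesgue_tuple R m (@rV_of_tuple R m @^-1` Y))%E -> Y !=set0.
Proof.
move=> posY; apply/set0P/eqP => YE; move: posY.
by rewrite YE preimage_set0 measure0 ltxx.
Qed.

(** * The entropic approximation: regularity and convergence *)

Section entropy.
Context (R : realType) (n m : nat) (OX : set 'rV[R]_n) (Y OY : set 'rV[R]_m).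
Context (g : 'rV[R]_n * 'rV[R]_m -> R) (g_ : R -> 'rV[R]_n * 'rV[R]_m -> R).
Hypotheses (compactY : compact Y) (convexY : convex_set Y).
Hypothesis posY : (0 < lebesgue_tuple R m (@rV_of_tuple R m @^-1` Y))%E.
Hypotheses (openOX : open OX) (openOY : open OY) (subY : Y `<=` OY).
Hypothesis lipg : lipschitz g.
Hypothesis C1g : forall mu, 0 < mu -> continuously_differentiable_on (OX `*` OY) (g_ mu).
Hypothesis unifg : forall Omega : set 'rV[R]_n,
  open Omega -> closure Omega `<=` OX ->
  {uniform closure Omega `*` Y, g_ @ 0^'+ --> g}.

Let Y0 : Y !=set0. Proof. exact: lebesgue_tuple_gt0_nonempty posY. Qed.

Let openO : open (OX `*` OY). Proof. exact: open_setX. Qed.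

Let kernel mu z := expR (- mu^-1 * g_ mu z).

Let C1kernel mu : 0 < mu -> continuously_differentiable_on (OX `*` OY) (kernel mu).
Proof. by move=> mu0; apply: continuously_differentiable_expR => //; exact: C1g. Qed.

Let ckernel mu x : 0 < mu -> OX x -> {within Y, continuous (fun y => kernel mu (x, y))}.
Proof.
move=> mu0 OXx; apply: (slice_continuous (C1kernel mu0)) => y Yy.
by split => //; exact: subY.
Qed.

Let F mu x := rV_integral Y (fun y => kernel mu (x, y)).

Let F_gt0 mu x : 0 < mu -> OX x -> 0 < F mu x.
Proof.
move=> mu0 OXx; apply: rV_integral_gt0 => //; first exact: ckernel.
by move=> y _; exact: expR_gt0.
Qed.

Lemma continuously_differentiable_integral_entropy mu : 0 < mu ->
  continuously_differentiable_on OX (integral_entropy Y g_ mu).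
Proof.
move=> mu0; apply: (continuously_differentiable_ln (- mu) openOX (phi := F mu)).
  by move=> x; exact: F_gt0.
apply: (continuously_differentiable_rV_integral openO compactY (C1kernel mu0)).
by move=> x y OXx Yy; split => //; exact: subY.
Qed.

(** The hypothesis of uniform convergence is applied to a ball around [x] of half the radius of one
    contained in [OX], so that its closure still lies in [OX]. *)
Lemma uniform_near (x : 'rV[R]_n) (e : R) : OX x -> 0 < e ->
  \forall p \near (nbhs x, 0^'+), OX p.1 /\
    forall y, Y y -> `|g (p.1, y) - g_ p.2 (p.1, y)| < e.
Proof.
move=> OXx e0.
have /nbhs_ballP[r /= r0 rOX] : nbhs x OX by exact: open_nbhs_nbhs.
have clOX : closure (ball x (r / 2)) `<=` OX.
  apply: subset_trans rOX; apply: closed_ball_subset; first by rewrite divr_gt0.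
  by rewrite ltr_pdivrMr // ltr_pMr // ltr1n.
have P : nbhs (g : {uniform` (closure (ball x (r / 2)) `*` Y) -> R})
    [set h | forall p, (closure (ball x (r / 2)) `*` Y) p -> `|g p - h p| < e].
  apply/uniform_nbhs; exists [set p | ball p.1 e p.2]; split.
    exact: entourage_ball (PosNum e0).
  by move=> h /= gh p /gh; rewrite -ball_normE.
have r2 : 0 < r / 2 by rewrite divr_gt0.
exists (ball x (r / 2), [set mu | forall p,
    (closure (ball x (r / 2)) `*` Y) p -> `|g p - g_ mu p| < e]).
  by split; [exact: nbhsx_ballx|exact: unifg (ball_open x (r / 2)) clOX _ P].
move=> [z mu] [/= xz gmu].
have clz : closure (ball x (r / 2)) z by exact: subset_closure.
by split=> [|y Yy]; [exact: clOX|exact: gmu].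
Qed.

Lemma integral_entropy_cvg x : OX x ->
  integral_entropy Y g_ p.2 p.1 @[p --> (nbhs x, 0^'+)] --> value_function Y g x.
Proof.
move=> OXx; apply/cvgrPdist_le => e e0.
have [k k0 gk] := lipschitz_bound lipg.
have [ys Yys [vE vmin]] :=
  value_function_attained compactY Y0 (@lipschitz_continuous_slice _ _ _ Y _ x lipg).
set v := value_function Y g x in vE vmin *.
(* One third each for the error of [g_ mu], the Lipschitz variation of [g] and the logarithmic term.
   Moving by at most [d / k] changes [g] by at most [d]. *)
pose d := e / 3; have d0 : 0 < d by rewrite divr_gt0.
have dk0 : 0 < d / k by rewrite divr_gt0.
pose N := Y `&` closed_ball ys (d / k).
have cN : compact N.
  by apply: compact_closedI => //; exact: closed_ball_closed.
have posN := lebesgue_tuple_convex_ball_gt0 compactY convexY Yys dk0 posY.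
set A := fine (lebesgue_tuple R m (@rV_of_tuple R m @^-1` Y)).
set B := fine (lebesgue_tuple R m (@rV_of_tuple R m @^-1` N)).
have A0 : 0 < A by rewrite fine_gt0 // posY lebesgue_tuple_compact_lty.
have B0 : 0 < B by rewrite fine_gt0 // posN lebesgue_tuple_compact_lty.
have bound mu z : 0 < mu -> OX z -> `|x - z| <= d / k ->
    (forall y, Y y -> `|g (z, y) - g_ mu (z, y)| < d) ->
    `|mu * ln A| <= d -> `|mu * ln B| <= d ->
    `|v - integral_entropy Y g_ mu z| <= e.
  move=> mu0 OXz xz gz lnA lnB.
  have cexp a : {within Y, continuous (cst a : 'rV[R]_m -> R)}.
    exact/continuous_subspaceT/cst_continuous.
  have kmax a b : a <= d / k -> b <= d / k -> k * Num.max a b <= d.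
    by move=> ad bd; rewrite mulrC -ler_pdivlMr // ge_max ad.
  (* The integral is bounded below by its part over [N], where [g_ mu (z, y)] is at most [v + 2 * d]
     because [(z, y)] is close to [(x, ys)]. *)
  have ub : integral_entropy Y g_ mu z <= (v + 2 * d) - mu * ln B.
    apply: le_ln_Laplace => //.
    rewrite -rV_integral_cst //.
    apply: (@le_trans _ _ (rV_integral N (fun y => kernel mu (z, y)))).
      apply: le_rV_integral => //.
      - exact/continuous_subspaceT/cst_continuous.
      - by apply: continuous_subspaceW (ckernel mu0 OXz) => y [].
      move=> y [Yy]; rewrite closed_ballE // /closed_ball_ /= => ysy.
      rewrite /kernel /= ler_expR !mulNr lerN2 ler_pM2l ?invr_gt0 //.
      have := gk (x, ys) (z, y); rewrite norm_pairB => /le_trans/(_ (kmax _ _ xz ysy)).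
      have := gz y Yy; rewrite -vE ltr_norml ler_norml => /andP[h1 h2] /andP[h3 h4].
      lra.
    apply: rV_integral_subset => //.
    - by move=> y [].
    - exact: ckernel.
    - by move=> y _; exact: expR_ge0.
  (* Here the bound [g_ mu (z, y) >= v - 2 * d] holds on all of [Y], since [v] is at most
     [g (x, y)]. *)
  have lb : (v - 2 * d) - mu * ln A <= integral_entropy Y g_ mu z.
    apply: (@ge_ln_Laplace _ _ _ _ (F mu z)) => //; first exact: F_gt0.
    rewrite /F -rV_integral_cst //.
    apply: le_rV_integral => //; first exact: ckernel.
    move=> y Yy; rewrite /= ler_expR !mulNr lerN2 ler_pM2l ?invr_gt0 //.
    have := gk (x, y) (z, y); rewrite norm_pairB subrr normr0.
    move=> /le_trans/(_ (kmax _ _ xz (ltW dk0))).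
    have := gz y Yy; rewrite ltr_norml ler_norml => /andP[h1 h2] /andP[h3 h4].
    have := vmin y Yy; lra.
  move: lnA lnB; rewrite !ler_norml => /andP[a1 a2] /andP[b1 b2].
  have ed : e = 3 * d by rewrite /d mulrC divfK.
  by rewrite ed; apply/andP; split; lra.
have near_x := @near_dist_le _ _ x _ dk0.
have near_mu : \forall mu \near 0^'+, [/\ 0 < mu, `|mu * ln A| <= d & `|mu * ln B| <= d].
  near=> mu; split; near: mu; [exact: nbhs_right_gt|exact: near0_mulr_le..].
have near_p : \forall p \near (nbhs x, 0^'+), `|x - p.1| <= d / k /\
    [/\ 0 < p.2, `|p.2 * ln A| <= d & `|p.2 * ln B| <= d].
  by exists ([set z | `|x - z| <= d / k],
    [set mu | [/\ 0 < mu, `|mu * ln A| <= d & `|mu * ln B| <= d]]).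
have near_g := uniform_near OXx d0.
apply: filterS2 near_g near_p => p [OXp gp] [xp [p0 pA pB]].
exact: bound.
Unshelve. all: by end_near. Qed.

End entropy.

Theorem theorem4p4 (R : realType) (n m : nat)
    (X OX : set 'rV[R]_n) (Y OY : set 'rV[R]_m)
    (g : 'rV[R]_n * 'rV[R]_m -> R) (g_ : R -> 'rV[R]_n * 'rV[R]_m -> R)
    (closedX : closed X) (convexX : convex_set X)
    (compactY : compact Y) (convexY : convex_set Y)
    (posY : (0 < lebesgue_tuple R m (@rV_of_tuple R m @^-1` Y))%E)
    (openOX : open OX) (subX : X `<=` OX)
    (openOY : open OY) (subY : Y `<=` OY)
    (lipg : lipschitz g)
    (approxg : smooth_approximations (OX `*` OY) g g_)
    (unifg : forall Omega : set 'rV[R]_n,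
      open Omega -> closure Omega `<=` OX ->
      {uniform closure Omega `*` Y, g_ @ 0^'+ --> g}) :
  smooth_approximations OX (value_function Y g) (integral_entropy Y g_).
Proof.
have [_ C1g _] := approxg.
split.
- by move=> x _; apply: value_function_continuous => //; exact: lebesgue_tuple_gt0_nonempty posY.
- by apply: (@continuously_differentiable_integral_entropy R n m OX Y OY).
- by apply: (@integral_entropy_cvg R n m OX Y OY).
Qed.
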